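(* Let $k\in\mathbb{Z}$ and $n,m\in\mathbb{Z}^+$. Then $\chi_{n,k}(T_m)=2$ if $n\mid mk$, and $\chi_{n,k}(T_m)=3$ otherwise.
   Context: $T_m$ is the complete $m$-ary rooted tree of infinite height: an infinite rooted tree in which every vertex has exactly $m$ children. For a graph $G=(V,E)$, a labeling $\ell:V\to\mathbb{Z}$ is proper if adjacent vertices get distinct labels, its order is the size of its image, and it is a closed coloring with remainder $k\bmod n$ if $\sum_{w\in N[v]}\ell(w)\equiv k\pmod n$ for every $v$, where $N[v]$ is the closed neighborhood of $v$. $\chi_{n,k}(G)$ is the minimum order of a proper closed coloring with remainder $k\bmod n$. *)

(* Defs.v *)
From HB Require Import structures.
From mathcomp Require Import all_boot all_order all_algebra.
From mathcomp Require Import boolp classical_sets functions cardinality fsbigop.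

Set Implicit Arguments.
Unset Strict Implicit.
Unset Printing Implicit Defensive.

Import Order.TTheory GRing.Theory Num.Theory.
Local Open Scope classical_set_scope.
Local Open Scope card_scope.
Local Open Scope ring_scope.

(* Simple graphs, possibly infinite; local finiteness is what makes the sum
   of the labels over a closed neighborhood meaningful. *)
Record graph := Graph {
  vertex :> choiceType;
  adj : rel vertex;
  adj_sym : symmetric adj;
  adj_irr : irreflexive adj;
  adj_fin : forall v, finite_set [set w | adj v w]
}.

Definition closed_nbhd (G : graph) (v : G) : set G :=
  [set v] `|` [set w | adj v w].

Definition proper_labeling (G : graph) (l : G -> int) : Prop :=
  forall u v : G, adj u v -> l u <> l v.

Definition closed_coloring (G : graph) (n : nat) (k : int) (l : G -> int) : Prop :=
  forall v : G, (\sum_(w \in closed_nbhd v) l w = k %[mod n])%Z.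

Definition proper_closed_coloring (G : graph) (n : nat) (k : int)
    (l : G -> int) : Prop :=
  proper_labeling l /\ closed_coloring n k l.

(* [is_chi G n k r] says that chi_{n,k}(G) = r. The order of a labeling is the
   cardinality of its range; comparing cardinals covers labelings of infinite
   order as well. *)
Definition is_chi (G : graph) (n : nat) (k : int) (r : nat) : Prop :=
  (exists2 l : G -> int, proper_closed_coloring n k l & range l #= `I_r) /\
  (forall l : G -> int, proper_closed_coloring n k l -> `I_r #<= range l).

Lemma is_chi_uniq (G : graph) (n : nat) (k : int) (r s : nat) :
  is_chi G n k r -> is_chi G n k s -> r = s.
Proof.
move=> [[l lP lr] rmin] [[l' l'P ls] smin].
have := rmin _ l'P; rewrite (card_le_eqr ls) card_le_II => le_rs.
have := smin _ lP; rewrite (card_le_eqr lr) card_le_II => le_sr.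
by apply/eqP; rewrite eqn_leq le_rs.
Qed.

(* A vertex of T_m is the list of choices leading to it from the root [::],
   the latest choice first: the children of u are the i :: u with i : 'I_m. *)
Definition child (m : nat) (u v : seq 'I_m) : bool :=
  if v is _ :: p then p == u else false.

Definition tree_adj (m : nat) : rel (seq 'I_m) :=
  fun u v => child u v || child v u.

Lemma tree_adj_sym (m : nat) : symmetric (@tree_adj m).
Proof. by move=> u v; rewrite /tree_adj orbC. Qed.

Lemma tree_adj_irr (m : nat) : irreflexive (@tree_adj m).
Proof.
move=> [|i u] //; rewrite /tree_adj orbb /=.
by apply/eqP => /(congr1 size)/= /n_Sn.
Qed.

Lemma tree_adj_fin (m : nat) (v : seq 'I_m) : finite_set [set w | tree_adj v w].
Proof.
apply: (@sub_finite_set _ _ ([set behead v] `|` range (fun i => i :: v))).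
  move=> w /orP[|]; first by case: w => //= i p /eqP->; right; exists i.
  by case: v => //= i p /eqP->; left.
by rewrite finite_setU; split => //; apply: finite_image; exact: finite_finset.
Qed.

Definition T (m : nat) : graph :=
  Graph (@tree_adj_sym m) (@tree_adj_irr m) (@tree_adj_fin m).

(* Main.v *)
(* Two labels force the bipartition of the tree: with a on even and b on odd
   depths, comparing the sums at the root and at depths 1 and 2 gives b = 0,
   a = k and m k = 0 mod n.  When n does not divide m k, the labels k, 0, n
   suffice: label by k a perfect code of T_m (every closed neighborhood contains
   exactly one of its vertices), and color the rest properly by 0 and n, both
   null mod n. *)
Require Import Defs.
From mathcomp Require Import all_boot all_order all_algebra finmap.
From mathcomp Require Import boolp classical_sets cardinality fsbigop.
From mathcomp Require Import zify ring.

Import GRing.Theory.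
Local Open Scope ring_scope.

Section LabelingsOfGraphs.
Set Implicit Arguments.
Unset Strict Implicit.

Lemma card_set_uniq (A : choiceType) (s : seq A) :
  uniq s -> ([set` s] #= `I_(size s))%card.
Proof.
move=> us; have -> : [set` s]%classic = [set` [fset x in s]%fset]%classic.
  by apply/seteqP; split=> x /=; rewrite inE.
by apply/card_eq_fsetP; rewrite card_fseq undup_id.
Qed.

(** Lower bounds on the order come from exhibiting vertices with pairwise distinct labels. *)
Lemma card_le_range (A B : choiceType) (l : A -> B) (s : seq A) :
  uniq (map l s) -> (`I_(size s) #<= range l)%card.
Proof.
move=> us; rewrite -(size_map l) -(card_le_eql (card_set_uniq us)).
by apply: subset_card_le => x /= /mapP[v _ ->]; exists v.
Qed.

Lemma card_eq_range (A B : choiceType) (l : A -> B) (s : seq A) :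
  uniq (map l s) -> (forall v, l v \in map l s) ->
  (range l #= `I_(size s))%card.
Proof.
move=> us ls; rewrite -(size_map l).
suff -> : range l = [set` map l s]%classic by exact: card_set_uniq.
apply/seteqP; split=> x /=; first by move=> [v _ <-].
by move=> /mapP[v _ ->]; exists v.
Qed.

(** Irreflexivity of [adj] keeps [v] out of [s], so [v :: s] lists the closed neighborhood without
    repetition. *)
Lemma closed_nbhd_sum (G : graph) (v : G) (s : seq G) (l : G -> int) :
  uniq s -> (forall w, adj v w = (w \in s)) ->
  \sum_(w \in closed_nbhd v) l w = l v + \sum_(w <- s) l w.
Proof.
move=> us vs; have -> : closed_nbhd v = [set` v :: s]%classic.
  apply/seteqP; split=> w; rewrite /closed_nbhd /= inE vs.
    by case=> [->|->]; rewrite ?eqxx ?orbT.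
  by case/orP => [/eqP->|]; [left|right].
by rewrite -fsbig_seq ?big_cons //= us -vs adj_irr.
Qed.

End LabelingsOfGraphs.

Section Tree.
Set Implicit Arguments.
Unset Strict Implicit.
Variables (m n : nat) (k : int).
Implicit Types (l : T m -> int) (u v w : seq 'I_m) (i j : 'I_m).

Lemma uniq_children v : uniq [seq j :: v | j <- enum 'I_m].
Proof. by rewrite map_inj_uniq ?enum_uniq // => i j []. Qed.

Lemma mem_children v w : (w \in [seq j :: v | j <- enum 'I_m]) = child v w.
Proof.
case: w => [|j w] /=; first by apply/mapP => -[].
by apply/mapP/eqP => [[i _ []]//|->]; exists j; rewrite ?mem_enum.
Qed.

(** The root is split off because it alone has no parent. *)
Lemma closed_coloring_treeP l :
  closed_coloring n k l <->
  (n %| l [::] + \sum_j l [:: j] - k)%Z /\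
  (forall i u, (n %| l (i :: u) + l u + \sum_j l [:: j, i & u] - k)%Z).
Proof.
have root : \sum_(w \in closed_nbhd ([::] : T m)) l w = l [::] + \sum_j l [:: j].
  rewrite (closed_nbhd_sum l (uniq_children [::])) ?big_map ?big_enum //.
  by move=> w; rewrite mem_children /= /tree_adj orbF.
have cons i u : \sum_(w \in closed_nbhd (i :: u : T m)) l w =
    l (i :: u) + l u + \sum_j l [:: j, i & u].
  rewrite (@closed_nbhd_sum (T m) (i :: u)
    (u :: [seq j :: i :: u | j <- enum 'I_m])).
  - by rewrite big_cons big_map big_enum addrA.
  - rewrite /= uniq_children mem_children andbT; case: u => //= j u.
    by apply/eqP => /(congr1 size)/=; lia.
  - by move=> w; rewrite inE mem_children /= /tree_adj /= orbC eq_sym.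
split=> [lP|[lr lc] [|i u]].
- split=> [|i u]; first by rewrite -root -eqz_mod_dvd; apply/eqP/lP.
  by rewrite -cons -eqz_mod_dvd; apply/eqP/lP.
- by apply/eqP; rewrite eqz_mod_dvd root.
- by apply/eqP; rewrite eqz_mod_dvd cons.
Qed.

Lemma proper_labeling_treeP l :
  proper_labeling l <-> (forall i u, l (i :: u) <> l u).
Proof.
split=> [lP i u|lP u v].
  by apply: lP; rewrite /= /tree_adj /= eqxx orbT.
by case/orP; [case: v => //= i v /eqP-> /esym/lP|case: u => //= i u /eqP-> /lP].
Qed.

Hypotheses (hn : (0 < n)%N) (hm : (0 < m)%N).
Let i0 : 'I_m := Ordinal hm.

Lemma order_ge2 l : proper_labeling l -> (`I_2 #<= range l)%card.
Proof.
move=> /proper_labeling_treeP lP.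
apply: (@card_le_range _ _ l [:: [::]; [:: i0]]).
by rewrite /= inE andbT eq_sym; apply/eqP/lP.
Qed.

(** Adjacent labels differ, so with only two available each step away from the root swaps them. *)
Lemma two_labels_alternate l a b :
  proper_labeling l -> (forall v, l v \in [:: a; b]) -> l [::] = a ->
  forall v, l v = if odd (size v) then b else a.
Proof.
move=> /proper_labeling_treeP lP lab la; elim=> //= i v IH.
have := lP i v; have := lab (i :: v); rewrite !inE IH.
by case: odd => /= /orP[]/eqP->.
Qed.

Lemma alternating_closed_coloring l a b :
  (forall v, l v = if odd (size v) then b else a) ->
  closed_coloring n k l <->
  [/\ (n %| b)%Z, (n %| a - k)%Z & (n %| m%:Z * k)%Z].
Proof.
move=> lE; rewrite closed_coloring_treeP lE /=.
have sumE (c : int) : \sum_(j < m) c = m%:Z * c.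
  by rewrite sumr_const card_ord -mulr_natl natz.
under eq_bigr do rewrite lE; rewrite sumE.
have consE i u : l (i :: u) + l u + \sum_j l [:: j, i & u] =
    if odd (size u) then a + b + m%:Z * b else b + a + m%:Z * a.
  under eq_bigr do rewrite lE /= negbK; rewrite sumE !lE /=.
  by case: odd.
split=> [[root cons]|[nb na nk]].
  (* These are the conditions at depths 1 and 2; subtracting the root condition from [h2] leaves [b]
     alone. *)
  have /= h1 := cons i0 [::]; have /= h2 := cons i0 [:: i0].
  rewrite !consE /= in h1 h2.
  have nb : (n %| b)%Z.
    rewrite (_ : b = (a + b + m%:Z * b - k) - (a + m%:Z * b - k)); last by ring.
    exact: rpredB h2 root.
  have na : (n %| a - k)%Z.
    rewrite (_ : a - k = (a + m%:Z * b - k) - m%:Z * b); last by ring.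
    exact: rpredB root (dvdz_mull _ nb).
  split=> //.
  rewrite (_ : _ * _ = b + a + m%:Z * a - k - b - (1 + m%:Z) * (a - k)).
    exact: rpredB (rpredB h1 nb) (dvdz_mull _ na).
  by ring.
split=> [|i u].
  by rewrite addrAC; exact: rpredD (dvdz_mull _ nb).
rewrite consE; case: odd.
  rewrite (_ : _ - k = (a - k) + b + m%:Z * b); last by ring.
  exact: rpredD (rpredD na nb) (dvdz_mull _ nb).
rewrite (_ : _ - k = b + (1 + m%:Z) * (a - k) + m%:Z * k); last by ring.
exact: rpredD (rpredD nb (dvdz_mull _ na)) nk.
Qed.

Lemma is_chi_tree2 : (n %| m%:Z * k)%Z -> is_chi (T m) n k 2.
Proof.
move=> nmk; split; last by move=> l [/order_ge2].
(* The second label must vanish mod [n] and differ from [k]: [0] does, unless [k] is [0], and then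
   [n] does. *)
pose b : int := if k == 0 then n%:Z else 0.
have kb : k != b by rewrite /b; have [->|] := eqVneq k 0; lia.
pose l (v : T m) : int := if odd (size v) then b else k.
exists l.
  split; last first.
    apply/(@alternating_closed_coloring l k b) => //; split=> //.
      by rewrite /b; case: ifP; rewrite ?dvdzz ?dvdz0.
    by rewrite subrr dvdz0.
  apply/proper_labeling_treeP => i u; rewrite /l /=.
  by case: odd => /= /eqP; rewrite ?(negbTE kb) // eq_sym (negbTE kb).
apply: (@card_eq_range _ _ l [:: [::]; [:: i0]]) => [|v].
  by rewrite /= inE kb.
by rewrite !inE {1 3}/l; case: odd; rewrite eqxx ?orbT.
Qed.

Lemma order_ge3 l :
  ~~ (n %| m%:Z * k)%Z -> proper_closed_coloring n k l ->
  (`I_3 #<= range l)%card.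
Proof.
move=> nmk [lP lc]; set a := l [::]; set b := l [:: i0].
have ba : b != a by apply/eqP; move/proper_labeling_treeP: lP; apply.
(* Either a third label occurs, or the labeling alternates between [a] and [b], which forces [n] to
   divide [m * k]. *)
have [[v lv]|no3] := pselect (exists v, l v \notin [:: a; b]).
  apply: (@card_le_range _ _ l [:: v; [::]; [:: i0]]).
  by rewrite /= lv inE eq_sym ba.
have lab v : l v \in [:: a; b].
  by apply/negPn/negP => lv; apply: no3; exists v.
have lE := @two_labels_alternate l a b lP lab erefl.
by have [_ _] := (alternating_closed_coloring lE).1 lc; rewrite (negPf nmk).
Qed.

(* Since [code_label] takes the values [k], [0] and [n], subtraction from [n]
   exchanges [0] and [n].  The root being labeled [k], the branch [else false]
   is never reached. *)
Fixpoint code_label v : int :=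
  if v is i :: u then
    if code_label u == k then 0
    else if (i == i0) && (if u is _ :: p then code_label p != k else false)
      then k
    else n%:Z - code_label u
  else k.

Lemma code_label_range v : code_label v \in [:: k; 0; n%:Z].
Proof.
elim: v => [|i u]; rewrite /= ?inE ?eqxx //.
case: eqVneq => [_ _|_ /=]; first by rewrite eqxx orbT.
case: ifP => _; first by rewrite eqxx.
by case/orP => /eqP->; rewrite ?subr0 ?subrr eqxx ?orbT.
Qed.

Hypothesis nk : ~~ (n %| k)%Z.

(** With [k_neqn], this separates [k] from the other two labels, so that the label [k] marks exactly
    the code vertices. *)
Let k_neq0 : k != 0.
Proof. by apply: contraNneq nk => ->; rewrite dvdz0. Qed.

Let k_neqn : k != n.
Proof. by apply: contraNneq nk => ->. Qed.

Lemma code_label_dvd v : code_label v != k -> (n %| code_label v)%Z.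
Proof.
have := code_label_range v; rewrite !inE.
by case/or3P => /eqP->; rewrite ?eqxx ?dvdz0 ?dvdzz.
Qed.

Lemma code_label_proper : proper_labeling (code_label : T m -> int).
Proof.
apply/proper_labeling_treeP => i u /=.
have := code_label_range u; rewrite !inE.
case: eqVneq => [-> _|uk /= u0n]; first by apply/eqP; rewrite eq_sym.
case: ifP => _; first by apply/eqP; rewrite eq_sym.
(* The label of [u] is [0] or [n], and subtraction from the positive [n] fixes neither. *)
by move: u0n; lia.
Qed.

(** Labels outside the code vanish mod [n], so it is enough that each closed neighborhood contains
    one code vertex: the vertex itself, its parent, or its child of index [i0]. *)
Lemma code_label_closed : closed_coloring n k (code_label : T m -> int).
Proof.
apply/closed_coloring_treeP; split=> [|i u].
  by rewrite /= eqxx big1_eq addr0 subrr dvdz0.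
have nsub v : code_label v != k -> (n %| n%:Z - code_label v)%Z.
  by move=> vk; rewrite rpredB ?dvdzz ?code_label_dvd.
set x := code_label (i :: u).
have childE j : code_label [:: j, i & u] =
    if x == k then 0
    else if (j == i0) && (code_label u != k) then k else n%:Z - x by [].
under eq_bigr do rewrite childE.
(* If the vertex is in the code, its children are all labeled [0], and properness keeps its parent
   out of the code. *)
have [xk|xk] := eqVneq x k.
  rewrite big1_eq addr0 addrAC xk subrr add0r code_label_dvd //.
  apply/eqP => uk; have /proper_labeling_treeP/(_ i u) := code_label_proper.
  by rewrite -/x xk uk.
have nx := nsub _ xk; have xn := code_label_dvd xk; rewrite -/x in nx xn.
(* If the parent is in the code, no child is, not even the one of index [i0]. *)
have [uk|uk] := eqVneq (code_label u) k.
  rewrite uk addrAC addrK; under eq_bigr do rewrite andbF.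
  by rewrite rpredD // rpred_sum.
(* Neither the vertex nor its parent is in the code, so the child of index [i0] supplies the only
   [k]. *)
rewrite (bigD1 i0) //=.
rewrite (_ : _ - k = x + code_label u +
    \sum_(j | j != i0) (if (j == i0) && true then k else n%:Z - x)); last by ring.
rewrite !rpredD ?code_label_dvd ?rpred_sum // => j /negbTE->.
exact: nx.
Qed.

Lemma code_label_order : (range code_label #= `I_3)%card.
Proof.
(* The vertex [[:: i0; i0]] gets [n - 0] and not [k], since its grandparent, the root, is in the
   code. *)
have labels : map code_label [:: [::]; [:: i0]; [:: i0; i0]] = [:: k; 0; n%:Z].
  by rewrite /= !eqxx /= eq_sym (negPf k_neq0) subr0.
apply: (@card_eq_range _ _ code_label [:: [::]; [:: i0]; [:: i0; i0]]);
  rewrite labels; last exact: code_label_range.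
rewrite /= !inE negb_or k_neq0 k_neqn /= andbT; lia.
Qed.

End Tree.

Theorem theorem5p1 (k : int) (n m : nat) (hn : (0 < n)%N) (hm : (0 < m)%N) :
  is_chi (T m) n k (if (n%:Z %| m%:Z * k)%Z then 2%N else 3%N).
Proof.
case: ifPn => [|nmk]; first exact: is_chi_tree2.
split=> [|l lP]; last exact: order_ge3 lP.
have nk : ~~ (n %| k)%Z by apply: contra nmk; exact: dvdz_mull.
exists (code_label n k hm); last exact: code_label_order.
by split; [exact: code_label_proper|exact: code_label_closed].
Qed.
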